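(* Let $\mathfrak g$ be a solvable Lie algebra, and let $\mathcal X:=\mathfrak g^n$, $\mathcal W:=\mathfrak g^r$ with $n,r\ge1$. Consider the dynamics $X^+=f(X,W)$, where $f:\mathcal X\times\mathcal W\to\mathcal X$ is a Lie function with linear part $A:\mathcal X\to\mathcal X$ in the state, such that: (1) $f$ belongs to class-$\mathcal A$; (2) the origin of $\mathcal X$ is the unique equilibrium, i.e. for $X\in\mathcal X$, $f(X,W)=X$ for all $W\in\mathcal W$ if and only if $X=0$; (3) there is a nilpotent ideal $\mathfrak h\subseteq\mathfrak g$ with $\mathfrak h\supseteq[\mathfrak g,\mathfrak g]$ such that $f\big((\mathfrak h^{(i)})^n,\mathcal W\big)\subseteq(\mathfrak h^{(i)})^n$ for every ideal $\mathfrak h^{(i)}$ of the lower central series of $\mathfrak h$. If $A$ is Schur, and $W[k]\to\mathfrak h^r$ as $k\to\infty$, then there exists $\beta>0$ such that if $\limsup_{k\to\infty}\|W[k]\|\le\beta$, then the origin of $\mathcal X$ is globally attractive.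
   Context: All vector spaces are finite dimensional over $\mathbb F\in\{\mathbb R,\mathbb C\}$. $\mathfrak g$ is a (matrix) Lie algebra with a norm $\|\cdot\|$, and $\mu\in[0,2]$ is a constant with $\|[X,Y]\|\le\mu\|X\|\|Y\|$ for all $X,Y\in\mathfrak g$. Cartesian powers carry the sum norm. A linear map is Schur if its spectral radius $\rho$ is less than $1$. Lower central series of $\mathfrak h$: $\mathfrak h^{(1)}:=\mathfrak h$, $\mathfrak h^{(i+1)}:=[\mathfrak h^{(i)},\mathfrak h]$; $\mathfrak h$ is nilpotent if $\mathfrak h^{(p+1)}=0$ for some finite $p$. $\mathfrak g$ is solvable if its derived series $\mathfrak g_0=\mathfrak g$, $\mathfrak g_{i+1}=[\mathfrak g_i,\mathfrak g_i]$ reaches $0$. System: $X^+=f(X,W)$ means $X[k+1]=f(X[k],W[k])$, $k\ge0$, with state $X=(X_1,\dots,X_n)\in\mathcal X$ and exogenous signal $W=(W_1,\dots,W_r)\in\mathcal W$ that does not depend on $X$. A word $\omega$ of length $|\omega|$ is a nested bracket $[Y_{\omega_1},[Y_{\omega_2},[\dots,Y_{\omega_{|\omega|}}]\cdots]$ with letters $Y_{\omega_j}$ in $\widetilde X\cup\widetilde W$, where $\widetilde X=\{X_1,\dots,X_n\}$ and $\widetilde W=\{W_1,\dots,W_r\}$. A Lie function is a function whose components are (possibly infinite) linear combinations of words in its arguments. It belongs to class-$\mathcal A$ if, for each component with scalar coefficients $c_\omega$, there is a neighbourhood of the origin on which $\sum_\omega\mu^{|\omega|-1}|c_\omega|\|Y_{\omega_1}\|\cdots\|Y_{\omega_{|\omega|}}\|<\infty$.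 Under the stated hypotheses the dynamics are written as $f(X,W)=AX+\sum_\omega c_\omega\otimes\omega$, where $A:\mathcal X\to\mathcal X$ is linear, the sum is over words of length at least $2$, every word has at least one letter in $\widetilde X$, and $c_\omega\in\mathbb F^n$ (with $\mathfrak g^n\cong\mathbb F^n\otimes\mathfrak g$). $W[k]\to\mathfrak h^r$ means that the distance from $W[k]$ to the subspace $\mathfrak h^r$ tends to $0$. Globally attractive: $X[k]\to0$ as $k\to\infty$ for every initial condition $X[0]\in\mathcal X$. *)

(* Defs.v *)
From HB Require Import structures.
From mathcomp Require Import all_boot all_order all_algebra.
From mathcomp Require Import complex.
From mathcomp Require Import all_classical all_reals all_analysis.

Set Implicit Arguments.
Unset Strict Implicit.
Unset Printing Implicit Defensive.

Import Order.TTheory GRing.Theory Num.Theory.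
Import numFieldNormedType.Exports.

Local Open Scope classical_set_scope.
Local Open Scope ring_scope.

Variant scalar_kind := RealScalars | ComplexScalars.

Definition base_field (R : realType) (K : scalar_kind) : numFieldType :=
  match K with
  | RealScalars => R
  | ComplexScalars => R[i]
  end.

Definition to_complex (R : realType) (K : scalar_kind) : base_field R K -> R[i] :=
  match K return base_field R K -> R[i] with
  | RealScalars => fun x => real_complex R x
  | ComplexScalars => fun z => z
  end.

(* The norm of the numFieldType R[i] is R[i]-valued; this one is R-valued. *)
Definition modulus (R : realType) (K : scalar_kind) (a : base_field R K) : R :=
  Normc.normc (to_complex a).

Section VectorSpaces.
Variables (R : realType) (K : scalar_kind).
Local Notation F := (base_field R K).

Definition is_norm (V : lmodType F) (nrm : V -> R) : Prop :=
  [/\ forall x, 0 <= nrm x,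
      forall x, nrm x = 0 -> x = 0,
      forall a x, nrm (a *: x) = modulus a * nrm x
    & forall x y, nrm (x + y) <= nrm x + nrm y].

(* The eigenvalues of a real map are those of its complexification, hence the
   passage through a matrix over R[i]. The supremum is over a finite set, and
   is 0 if V is the zero space. *)
Definition spectral_radius (V : vectType F) (A : 'End(V)) : R :=
  let M := map_mx (@to_complex R K) (passmx.mxof (vbasis fullv) (vbasis fullv) A) in
  sup [set Normc.normc a | a in [set a : R[i] | eigenvalue M a]].

Definition schur (V : vectType F) (A : 'End(V)) : Prop :=
  spectral_radius A < 1.

End VectorSpaces.

Section LieAlgebras.
Variables (F : fieldType) (g : vectType F) (br : g -> g -> g).

Definition is_lie_bracket : Prop :=
  [/\ forall a x y z, br (a *: x + y) z = a *: br x z + br y z,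
      forall a x y z, br x (a *: y + z) = a *: br x y + br x z,
      forall x, br x x = 0
    & forall x y z, br x (br y z) + br y (br z x) + br z (br x y) = 0].

(* [U, V]; brackets of basis vectors suffice to span it by bilinearity. *)
Definition lie_prod (U V : {vspace g}) : {vspace g} :=
  <<[seq br u v | u <- vbasis U, v <- vbasis V]>>%VS.

Definition derived_series (i : nat) : {vspace g} :=
  iter i (fun U => lie_prod U U) fullv.

Definition solvable_lie : Prop := exists i, derived_series i = 0%VS.

Definition lie_ideal (h : {vspace g}) : Prop :=
  forall x y, y \in h -> br x y \in h.

(* Indexed from 1 on: lower_central h 1 = h (and lower_central h 0 = h). *)
Definition lower_central (h : {vspace g}) (i : nat) : {vspace g} :=
  iter i.-1 (fun U => lie_prod U h) h.

Definition nilpotent_lie (h : {vspace g}) : Prop :=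
  exists p, lower_central h p.+1 = 0%VS.

Variables n r : nat.

(* inl i is the letter X_i and inr j is the letter W_j. *)
Definition letter : finType := ('I_n + 'I_r)%type.

Definition letter_val (X : {ffun 'I_n -> g}) (W : {ffun 'I_r -> g})
    (a : letter) : g :=
  match a with inl i => X i | inr j => W j end.

Fixpoint word_val (Y : letter -> g) (w : seq letter) : g :=
  match w with
  | [::] => 0
  | [:: a] => Y a
  | a :: w' => br (Y a) (word_val Y w')
  end.

(* All the words except those of length one in the state, which are accounted
   for by the linear part. *)
Definition series_word (w : seq letter) : bool :=
  match w with
  | [::] => false
  | [:: inl _] => false
  | _ => true
  end.

Definition word_sum (c : seq letter -> {ffun 'I_n -> F})
    (X : {ffun 'I_n -> g}) (W : {ffun 'I_r -> g}) (N : nat) :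
    {ffun 'I_n -> g} :=
  [ffun i => \sum_(l < N) \sum_(w : l.-tuple letter | series_word w)
               c w i *: word_val (letter_val X W) w].

End LieAlgebras.

Section Dynamics.
Variables (R : realType) (K : scalar_kind).
Local Notation F := (base_field R K).
Variables (g : vectType F) (br : g -> g -> g) (nrm : g -> R).

Definition sum_norm (m : nat) (X : {ffun 'I_m -> g}) : R := \sum_i nrm (X i).

Definition dist_pow (m : nat) (h : {vspace g}) (X : {ffun 'I_m -> g}) : R :=
  inf [set sum_norm (X - V) |
         V in [set V : {ffun 'I_m -> g} | forall j, V j \in h]].

Variables n r : nat.

(* f(X, W) = A X + \sum_w c_w (x) w, the series being summed by increasing word
   length; there are finitely many words of each length. Words without a state
   letter are allowed here. *)
Definition lie_function (f : {ffun 'I_n -> g} -> {ffun 'I_r -> g} ->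
      {ffun 'I_n -> g})
    (A : 'End({ffun 'I_n -> g}))
    (c : seq (letter n r) -> {ffun 'I_n -> F}) : Prop :=
  forall X W,
    (fun N => sum_norm (f X W - (A X + word_sum br c X W N))) @ \oo --> (0 : R).

Definition class_A (mu : R) (c : seq (letter n r) -> {ffun 'I_n -> F}) : Prop :=
  forall i : 'I_n, exists2 eps : R, 0 < eps &
    forall X W, sum_norm X + sum_norm W < eps ->
      (\esum_(w in [set w | series_word w])
         (mu ^+ (size w).-1 * modulus (c w i) *
          \prod_(a <- w) nrm (letter_val X W a))%:E < +oo)%E.

End Dynamics.

(* Main.v *)
Require Import Defs.
From HB Require Import structures.
From mathcomp Require Import all_boot all_order all_algebra.
From mathcomp Require Import complex.
From mathcomp Require Import all_classical all_reals all_analysis.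
From mathcomp Require Import ring lra.

Set Implicit Arguments.
Unset Strict Implicit.
Unset Printing Implicit Defensive.

Import Order.TTheory GRing.Theory Num.Theory.
Import numFieldNormedType.Exports.

Local Open Scope classical_set_scope.
Local Open Scope ring_scope.

(** The state is driven to zero modulo h, then modulo the second term h_2 of
    the lower central series of h, and so on; as h is nilpotent, finitely many
    stages reach zero itself.  At each stage the dynamics, seen modulo h_i, are
    a vanishing perturbation of the Schur map A.

    Write f(X, W) = A X + N(X, W).  By the equilibrium condition f(0, W) = 0,
    so N(0, W) = 0 and the words in the letters W alone contribute nothing.

    First stage: a word of length at least 2 is a commutator and hence lies in
    h, so that modulo h the dynamics are exactly X+ = A X.

    Inductive stage: suppose that X is at distance less than eps from h_i, that
    W is at distance less than eps from h, and that every letter of W has norm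
    at most d.  Split X = E + H with H in h_i and E of norm at most eps.
    - In N(E, W) every word that does not cancel contains a letter of E; class
      A makes the sum O(eps) as soon as d lies within the domain of absolute
      convergence.  This is where the bound beta on W comes from.
    - The difference N(E + H, W) - N(E, W) is a sum of words with a letter in
      h_i.  Bracketing such a word with an element of h sends it to h_(i+1), so
      modulo h_(i+1) each further letter only counts through its distance to h,
      which is at most eps, and only terms with a single letter of H survive
      (word_val_shift_close).  The change of a word of length m is therefore at
      most 2 (mu eps)^(m-1) |H| modulo h_(i+1), with |H| the distance from H to
      h_(i+1), however large that is: although class A is a local condition,
      these bounds are summable, and their sum is O(eps |H|).
    Together (dist_pow_step), the distance from N(X, W) to h_(i+1) is at most
    C eps (1 + D), where D is the distance from X to h_(i+1).  Since eps tends
    to 0 along the trajectory and A is a contraction modulo h_(i+1) for an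
    adapted norm (schur_adapted_dist), D tends to 0 (schur_dist_cvg0).

    The contraction property rests on two facts about finite dimensional
    spaces: any norm dominates the coordinates (coord_bound), and spectral
    radius below 1 forces the powers of A to tend to 0 (schur_iter_cvg0). *)

(** * Perturbed scalar contractions *)
Lemma cvg0_le (R : realType) (u : nat -> R) :
  (forall k, 0 <= u k) ->
  (forall e, 0 < e -> \forall k \near \oo, u k <= e) ->
  u @ \oo --> (0 : R).
Proof.
move=> u0 ue; apply/cvgr0Pnorm_le => e /ue; apply: filterS => k.
by rewrite ger0_norm.
Qed.

Lemma cvg0_near_le (R : realType) (u : nat -> R) (e : R) :
  u @ \oo --> (0 : R) -> 0 < e -> \forall k \near \oo, u k <= e.
Proof.
move=> /cvgr0Pnorm_le u0 /u0; apply: filterS => k; apply: le_trans.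
exact: ler_norm.
Qed.

Lemma cvg0_sum (R : realType) (I : Type) (s : seq I) (u : I -> nat -> R) :
  (forall i, u i @ \oo --> (0 : R)) ->
  (fun k => \sum_(i <- s) u i k) @ \oo --> (0 : R).
Proof.
move=> u0; elim: s => [|i s IH].
  by under eq_fun do rewrite big_nil; exact: cvg_cst.
have -> : (fun k => \sum_(j <- i :: s) u j k) =
    (fun k => u i k + \sum_(j <- s) u j k).
  by apply/funext => k; rewrite big_cons.
have : (fun k => u i k + \sum_(j <- s) u j k) @ \oo --> (0 + 0 : R).
  exact: (cvgD (u0 i) IH).
by rewrite addr0.
Qed.

(** For any t strictly between th and 1 the inequality eventually reads
    u (k+1) <= t u k + eta with eta as small as desired, and iterating it
    bounds u by a geometric sequence plus eta / (1 - t). *)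
Lemma perturbed_contraction (R : realType) (u e : nat -> R) (th : R) :
  0 <= th < 1 -> (forall k, 0 <= u k) -> e @ \oo --> (0 : R) ->
  (\forall k \near \oo, u k.+1 <= th * u k + e k * (1 + u k)) ->
  u @ \oo --> (0 : R).
Proof.
move=> /andP[th0 th1] u0 e0 ue; apply: cvg0_le => // eps eps0.
pose t := (1 + th) / 2.
have t0 : 0 <= t by rewrite /t; lra.
have t1 : 0 < 1 - t by rewrite /t; lra.
pose eta := Num.min (t - th) (eps / 2 * (1 - t)).
have eta0 : 0 < eta.
  by rewrite lt_min; apply/andP; split; [rewrite /t; lra|rewrite mulr_gt0 ?divr_gt0].
have [K _ HK] : \forall k \near \oo, u k.+1 <= t * u k + eta.
  apply: filterS2 ue (cvg0_near_le e0 eta0) => k uk ek; apply: le_trans uk _.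
  have : e k * (1 + u k) <= eta * (1 + u k) by rewrite ler_wpM2r ?addr_ge0.
  have : eta * u k <= (t - th) * u k by rewrite ler_wpM2r ?ge_min ?lexx.
  by lra.
have geo m : u (m + K)%N <= t ^+ m * u K + eta / (1 - t).
  elim: m => [|m IH].
    by rewrite expr0 mul1r add0n lerDl divr_ge0 // ltW.
  rewrite addSn; apply: le_trans (HK _ _) _; first exact: leq_addl.
  rewrite (_ : _ + eta / (1 - t) = t * (t ^+ m * u K + eta / (1 - t)) + eta).
    by rewrite lerD2r ler_wpM2l.
  by rewrite exprS; field; rewrite gt_eqF.
have eta_le : eta / (1 - t) <= eps / 2.
  by rewrite ler_pdivrMr // ge_min lexx orbT.
have : (fun m => t ^+ m * u K) @ \oo --> (0 : R).
  rewrite -(mul0r (u K)); apply: cvgMl; apply: cvg_expr.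
  by rewrite ger0_norm //; lra.
move/cvg0_near_le/(_ (divr_gt0 eps0 (ltr0Sn _ 1))) => [M _ HM].
exists (M + K)%N => // k /= Mk.
have -> : k = ((k - K) + K)%N by rewrite subnK // (leq_trans _ Mk) // leq_addl.
apply: le_trans (geo _) _.
have /HM /= : (M <= k - K)%N by rewrite leq_subRL ?(leq_trans _ Mk) ?leq_addl // addnC.
by lra.
Qed.

(** * Norms of finite dimensional spaces *)
Section Modulus.
Variables (R : realType) (K : scalar_kind).
Local Notation F := (base_field R K).

Lemma to_complexD : {morph @to_complex R K : x y / x + y}.
Proof. by case: K => x y //=; rewrite rmorphD. Qed.

Lemma to_complexM : {morph @to_complex R K : x y / x * y}.
Proof. by case: K => x y //=; rewrite rmorphM. Qed.

Lemma to_complex0 : @to_complex R K 0 = 0.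
Proof. by case: K. Qed.

Lemma modulus_ge0 (a : F) : 0 <= modulus a.
Proof. by rewrite /modulus; case: (to_complex a) => x y; exact: sqrtr_ge0. Qed.

Lemma modulusN1 : modulus (- 1 : F) = 1.
Proof.
rewrite /modulus (_ : to_complex _ = - 1) ?normcN ?Normc.normc1 //.
by case: K => //=; rewrite rmorphN1.
Qed.

Definition of_real : R -> F :=
  match K return R -> base_field R K with
  | RealScalars => id
  | ComplexScalars => real_complex R
  end.

Lemma modulus_of_real (a : R) : modulus (of_real a) = `|a|.
Proof.
by rewrite /modulus /of_real; case: K => /=;
  rewrite expr0n /= addr0 sqrtr_sqr.
Qed.

End Modulus.

Section NormFacts.
Variables (R : realType) (K : scalar_kind) (V : lmodType (base_field R K)).
Variables (nrm : V -> R) (nrmP : is_norm nrm).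

Lemma nrm_ge0 x : 0 <= nrm x. Proof. by case: nrmP. Qed.

Lemma nrm_eq0 x : nrm x = 0 -> x = 0. Proof. by case: nrmP => _ + _ _; exact. Qed.

Lemma nrmZ a x : nrm (a *: x) = modulus a * nrm x. Proof. by case: nrmP. Qed.

Lemma nrmD x y : nrm (x + y) <= nrm x + nrm y. Proof. by case: nrmP. Qed.

Lemma nrmN x : nrm (- x) = nrm x.
Proof. by rewrite -scaleN1r nrmZ modulusN1 mul1r. Qed.

Lemma nrm0 : nrm 0 = 0.
Proof.
by rewrite -(scale0r (0 : V)) nrmZ /modulus to_complex0 Normc.normc0 mul0r.
Qed.

Lemma nrmB x y : nrm (x - y) <= nrm x + nrm y.
Proof. by rewrite -(nrmN y) nrmD. Qed.

Lemma nrm_sum (I : Type) (s : seq I) (P : pred I) (E : I -> V) :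
  nrm (\sum_(i <- s | P i) E i) <= \sum_(i <- s | P i) nrm (E i).
Proof.
elim/big_rec2: _ => [|i y x _ yx]; first by rewrite nrm0.
by apply: le_trans (nrmD _ _) _; rewrite lerD2l.
Qed.

End NormFacts.

(** A real norm on row vectors is Lipschitz, hence attains on the compact unit
    sphere a minimum, which is positive. *)
Lemma rV_norm_lower_bound (R : realType) (m : nat) (N : 'rV[R]_m -> R) :
  (forall x y, N (x + y) <= N x + N y) ->
  (forall a x, N (a *: x) = `|a| * N x) ->
  (forall x, N x = 0 -> x = 0) ->
  exists2 C, 0 <= C & forall (x : 'rV[R]_m) (i : 'I_m), `|x 0 i| <= C * N x.
Proof.
case: m N => [|m] N ND NZ Ninj; first by exists 0 => // x [].
have N0 : N 0 = 0 by rewrite -(scale0r 0) NZ normr0 mul0r.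
have Nopp x : N (- x) = N x by rewrite -scaleN1r NZ normrN1 mul1r.
have Nge0 x : 0 <= N x.
  by have := ND x (- x); rewrite subrr N0 Nopp -mulr2n pmulrn_lge0.
pose L := \sum_i N (delta_mx 0 i).
have NL x : N x <= L * `|x|.
  rewrite {1}(matrix_sum_delta x) big_ord1 /L mulr_suml.
  elim/big_rec2: _ => [|i y1 y2 _ Hy]; first by rewrite N0.
  apply: le_trans (ND _ _) _; apply: lerD => //.
  rewrite NZ mulrC; apply: ler_wpM2l => //.
  by rewrite [leRHS]/Num.Def.normr /= mx_normrE; apply/bigmax_geP; right; exists (0, i).
have L0 : 0 <= L by apply: sumr_ge0.
have Nsub x y : `|N x - N y| <= N (x - y).
  rewrite ler_norml; apply/andP; split.
    by have := ND (y - x) x; rewrite subrK -(Nopp (y - x)) opprB; lra.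
  by have := ND (x - y) y; rewrite subrK; lra.
have Ncont : continuous N.
  move=> x; apply/(@cvgrPdist_le _ _ _ (nbhs x) _) => e e0.
  near=> y.
  apply: le_trans (Nsub _ _) _; apply: le_trans (NL _) _.
  have : `|x - y| <= e / (L + 1).
    near: y; have eL0 : 0 < e / (L + 1) by rewrite divr_gt0 // ltr_wpDl.
    exact: (@cvgr_dist_le _ _ _ (nbhs x) _ id x cvg_id _ eL0).
  rewrite ler_pdivlMr ?ltr_wpDl // => H; apply: le_trans H.
  by rewrite mulrC ler_wpM2l ?lerDl.
pose S := [set x : 'rV[R]_m.+1 | `|x| = 1].
have Scl : closed S.
  rewrite (_ : S = Num.Def.normr @^-1` [set 1 : R]) //.
  by apply: closed_comp => [x _|]; [exact: norm_continuous|exact: closed_eq].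
have Sbd : bounded_set S.
  by exists 1; split => // t t1 x /= ->; exact: ltW.
have S0 : S !=set0.
  exists (const_mx 1); rewrite /S /= /Num.Def.normr /= mx_normrE.
  apply/eqP; rewrite eq_le; apply/andP; split.
    by apply: bigmax_le => // i _; rewrite mxE normr1.
  by apply/bigmax_geP; right; exists (0, 0) => //; rewrite mxE normr1.
have [c cS cmin] := compact_EVT_min S0 (bounded_closed_compact Sbd Scl)
  (continuous_subspaceT Ncont).
move: cS; rewrite inE /S /= => c1.
have Nc : 0 < N c.
  rewrite lt_neqAle Nge0 andbT eq_sym; apply/eqP => /Ninj c0.
  by move: c1; rewrite c0 normr0 => /eqP; rewrite eq_sym oner_eq0.
exists (N c)^-1; first by rewrite invr_ge0 ltW.
move=> x i; apply: (@le_trans _ _ `|x|).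
  by rewrite [leRHS]/Num.Def.normr /= mx_normrE; apply/bigmax_geP; right; exists (0, i).
have [->|x0] := eqVneq x 0; first by rewrite normr0 N0 mulr0.
have nx : 0 < `|x| by rewrite normr_gt0.
have : N c <= N (`|x|^-1 *: x).
  apply: cmin; rewrite inE /S /= mx_normZ normfV normr_id mulVf //.
  by rewrite gt_eqF.
rewrite NZ normfV normr_id mulrC ler_pdivlMr // mulrC -ler_pdivlMr //.
by rewrite mulrC.
Unshelve. all: by end_near.
Qed.

Section CoordBound.
Variables (R : realType).

(** All norms of a finite dimensional space are equivalent; only this half,
    that a norm dominates the coordinates, needs compactness.  A complex space
    of dimension d is treated as a real one of dimension 2d, by listing the real
    parts and then the imaginary parts of the coordinates. *)
Lemma coord_bound (K : scalar_kind) (V : vectType (base_field R K))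
    (nrm : V -> R) : is_norm nrm ->
  exists2 C, 0 <= C &
    forall (x : V) i, modulus (coord (vbasis fullv) i x) <= C * nrm x.
Proof.
case: K V nrm => V nrm nrmP; set b := vbasis _; set d := \dim _ in b *.
  pose N (x : 'rV[R]_d) := nrm (\sum_i (x 0 i : base_field R RealScalars) *: b`_i).
  have [x y|a x|x|C C0 HC] := @rV_norm_lower_bound _ _ N.
  - rewrite /N; apply: le_trans (nrmD nrmP _ _); rewrite -big_split /=.
    by under eq_bigr do rewrite mxE scalerDl.
  - have <- : modulus (a : base_field R RealScalars) = `|a|.
      exact: (modulus_of_real RealScalars).
    rewrite /N -(nrmZ nrmP) scaler_sumr.
    by under eq_bigr do rewrite mxE -scalerA.
  - move=> /(nrm_eq0 nrmP) xb0; apply/rowP => i; rewrite mxE.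
    have /freeP : free b by exact: basis_free (vbasisP _).
    by apply.
  exists C => // x i.
  have := HC (\row_i coord b i x) i; rewrite mxE.
  rewrite (_ : `|_| = modulus (coord b i x)); last first.
    by rewrite -(modulus_of_real RealScalars).
  rewrite /N; under eq_bigr do rewrite mxE.
  by rewrite -(coord_vbasis (memvf x)).
pose z (x : 'rV[R]_(d + d)) i : R[i] := Complex (x 0 (lshift d i)) (x 0 (rshift d i)).
pose N (x : 'rV[R]_(d + d)) :=
  nrm (\sum_i (z x i : base_field R ComplexScalars) *: b`_i).
have [x y|a x|x|C C0 HC] := @rV_norm_lower_bound _ _ N.
- rewrite /N; apply: le_trans (nrmD nrmP _ _); rewrite -big_split /=.
  rewrite le_eqVlt; apply/orP; left; apply/eqP; congr nrm; apply: eq_bigr => i _.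
  by rewrite -scalerDl; congr (_ *: _); rewrite /z !mxE.
- rewrite -(modulus_of_real ComplexScalars a) /N -(nrmZ nrmP) scaler_sumr.
  congr nrm; apply: eq_bigr => i _; rewrite scalerA; congr (_ *: _).
  by rewrite /z !mxE /=; apply/eqP; rewrite eq_complex /= !mul0r subr0 addr0 !eqxx.
- move=> /(nrm_eq0 nrmP) xb0.
  have /freeP/(_ _ xb0) z0 : free b by exact: basis_free (vbasisP _).
  apply/rowP => i; rewrite mxE; case: (split_ordP i) => j ->.
    by case: (z0 j).
  by case: (z0 j).
exists (C + C); first exact: addr_ge0.
move=> x i; pose v : 'rV[R]_(d + d) :=
  row_mx (\row_i complex.Re (coord b i x)) (\row_i complex.Im (coord b i x)).
have Nv : N v = nrm x.
  rewrite /N [in RHS](coord_vbasis (memvf x)); congr nrm; apply: eq_bigr => j _.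
  congr (_ *: _); rewrite /z /v row_mxEl row_mxEr !mxE.
  by case: (coord b j x).
have := HC v (lshift d i); have := HC v (rshift d i).
rewrite Nv row_mxEl row_mxEr !mxE mulrDl => Him Hre.
apply: le_trans (lerD Hre Him); rewrite /modulus /=.
case: (coord b i x) => p q /=.
rewrite -[leRHS]ger0_norm ?addr_ge0 // -sqrtr_sqr ler_wsqrtr //.
rewrite sqrrD !real_normK ?num_real // -addrA lerD2l -[leLHS]add0r lerD2r.
by rewrite mulrn_wge0 // mulr_ge0.
Qed.

End CoordBound.

(** * Powers of a Schur map *)

Lemma linear_bounded (R : realType) (K : scalar_kind)
    (V : vectType (base_field R K)) (nrm : V -> R) (A : 'End(V)) :
  is_norm nrm -> exists2 a, 0 <= a & forall x, nrm (A x) <= a * nrm x.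
Proof.
move=> nrmP; have [C C0 HC] := coord_bound nrmP.
exists (\sum_(i < \dim {:V}) C * nrm (A (vbasis {:V})`_i)).
  by apply: sumr_ge0 => i _; rewrite mulr_ge0 // (nrm_ge0 nrmP).
move=> x; rewrite {1}(coord_vbasis (memvf x)) linear_sum.
apply: le_trans (nrm_sum nrmP _ _ _) _; rewrite mulr_suml.
apply: ler_sum => i _; rewrite linearZ (nrmZ nrmP) mulrAC.
by rewrite ler_wpM2r // (nrm_ge0 nrmP).
Qed.

(** If the product of the T - z, for z in s, kills v, then w = T v - z v is
    killed by one factor fewer, and the orbit of v obeys
    T^(k+1) v = z T^k v + T^k w: a contraction by |z| forced by the orbit of w,
    which tends to 0 by induction. *)
Lemma iter_linear_cvg0 (R : realType) (V : lmodType R[i])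
    (nrm : V -> R) (T : {linear V -> V}) (s : seq R[i]) (v : V) :
  is_norm (K := ComplexScalars) nrm ->
  {in s, forall z, Normc.normc z < 1} ->
  foldl (fun w z => T w - z *: w) v s = 0 ->
  (fun k => nrm (iter k T v)) @ \oo --> (0 : R).
Proof.
move=> nrmP; elim: s v => [|z s IH] v /= s1 v0.
  have -> : (fun k => nrm (iter k T v)) = fun=> 0; last exact: cvg_cst.
  apply/funext => k; rewrite v0 (_ : iter k T 0 = 0) ?(nrm0 nrmP) //.
  by elim: k => //= k ->; rewrite linear0.
have z1 : Normc.normc z < 1 by apply: s1; rewrite mem_head.
have /IH w0 : {in s, forall z, Normc.normc z < 1}.
  by move=> y ys; apply: s1; rewrite in_cons ys orbT.
have := w0 _ v0; set w := T v - _ => {}w0.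
have iterD k : iter k.+1 T v = iter k T w + z *: iter k T v.
  elim: k => [|k IHk]; first by rewrite /= /w subrK.
  by rewrite [LHS]iterS IHk linearD linearZZ -!iterS -IHk.
apply: (perturbed_contraction (th := Normc.normc z) _ _ w0).
- by rewrite z1 andbT; have := modulus_ge0 (K := ComplexScalars) z.
- by move=> k; exact: nrm_ge0 nrmP _.
near=> k; rewrite iterD; apply: le_trans (nrmD nrmP _ _) _.
rewrite (nrmZ nrmP) addrC /modulus /= lerD2l ler_peMr ?(nrm_ge0 nrmP) //.
by rewrite lerDl (nrm_ge0 nrmP).
Unshelve. all: by end_near.
Qed.

Section SpectralRadius.
Variables (R : realType).

Definition rV_l1 (d : nat) (v : 'rV[R[i]]_d) : R := \sum_i Normc.normc (v 0 i).

Lemma rV_l1_norm (d : nat) :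
  is_norm (K := ComplexScalars) (V := 'rV[R[i]]_d) (@rV_l1 d).
Proof.
have ge0 (z : R[i]) : 0 <= Normc.normc z.
  exact: (modulus_ge0 (K := ComplexScalars) z).
split.
- by move=> x; apply: sumr_ge0 => i _.
- move=> x /eqP; rewrite psumr_eq0 // => /allP x0; apply/rowP => i.
  by rewrite mxE; apply/Normc.eq0_normc/eqP/x0; rewrite mem_index_enum.
- move=> a x; rewrite mulr_sumr; apply: eq_bigr => i _.
  by rewrite mxE Normc.normcM.
- move=> x y; rewrite -big_split; apply: ler_sum => i _.
  by rewrite mxE /= le_normcD.
Qed.

Lemma foldl_horner_mx (C : comNzRingType) (d : nat) (M : 'M[C]_d.+1)
    (v : 'rV[C]_d.+1) s :
  foldl (fun w z => w *m M - z *: w) v s =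
  v *m horner_mx M (\prod_(z <- s) ('X - z%:P)).
Proof.
elim: s v => [|z s IH] v /=; first by rewrite big_nil rmorph1 mulmx1.
rewrite IH big_cons rmorphM /= -mulmxE mulmxA; congr (_ *m _).
by rewrite rmorphB /= horner_mx_X horner_mx_C mulmxBr mul_mx_scalar.
Qed.

(** By Cayley-Hamilton the product of the M - z over the eigenvalues z
    vanishes, so iter_linear_cvg0 applies to every vector. *)
Lemma mx_iter_cvg0 (d : nat) (M : 'M[R[i]]_d) (v : 'rV_d) :
  (forall a, eigenvalue M a -> Normc.normc a < 1) ->
  (fun k => rV_l1 (iter k (mulmxr M) v)) @ \oo --> (0 : R).
Proof.
case: d M v => [|d] M v M1.
  have -> : (fun k => rV_l1 (iter k (mulmxr M) v)) = fun=> 0.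
    by apply/funext => k; rewrite /rV_l1 big_ord0.
  exact: cvg_cst.
have [s chM] := closed_field_poly_normal (char_poly M).
rewrite (monicP (char_poly_monic M)) scale1r in chM.
apply: (iter_linear_cvg0 (s := s) (rV_l1_norm _)).
  move=> z zs; apply: M1; rewrite eigenvalue_root_char chM root_prod_XsubC //.
by rewrite foldl_horner_mx -chM Cayley_Hamilton mulmx0.
Qed.

(** A supremum is only meaningful for a bounded set; here the eigenvalues are
    the finitely many roots of the characteristic polynomial. *)
Lemma spectral_radius_ge (K : scalar_kind) (V : vectType (base_field R K))
    (A : 'End(V)) (a : R[i]) :
  eigenvalue (map_mx (@to_complex R K)
    (passmx.mxof (vbasis fullv) (vbasis fullv) A)) a ->
  Normc.normc a <= spectral_radius A.
Proof.
rewrite /spectral_radius; set M := map_mx _ _ => Ma.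
apply: ub_le_sup; last by exists a.
have [s chM] := closed_field_poly_normal (char_poly M).
rewrite (monicP (char_poly_monic M)) scale1r in chM.
have ge0 (z : R[i]) : 0 <= Normc.normc z.
  exact: (modulus_ge0 (K := ComplexScalars) z).
exists (\sum_(z <- s) Normc.normc z) => _ [z /= Mz <-].
move: Mz; rewrite eigenvalue_root_char chM root_prod_XsubC => zs.
by rewrite (big_rem z) //= lerDl sumr_ge0.
Qed.

Lemma schur_iter_cvg0 (K : scalar_kind) (V : vectType (base_field R K))
    (nrm : V -> R) (A : 'End(V)) (x : V) :
  is_norm nrm -> schur A -> (fun k => nrm (iter k A x)) @ \oo --> (0 : R).
Proof.
move=> nrmP schA; set b := vbasis (@fullv _ V).
have bP : basis_of fullv b := vbasisP _.
pose M := map_mx (@to_complex R K) (passmx.mxof b b A).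
pose v := map_mx (@to_complex R K) (passmx.rVof b x).
have Mk k : map_mx (@to_complex R K) (passmx.rVof b (iter k A x)) =
    iter k (mulmxr M) v.
  elim: k => //= k <-; rewrite (passmx.rVof_app _ bP) /mulmxr.
  apply/matrixP => i j; rewrite !mxE (big_morph _ (@to_complexD R K) (to_complex0 R K)).
  by apply: eq_bigr => l _; rewrite to_complexM !mxE.
have v0 := mx_iter_cvg0 v (fun a Ma => le_lt_trans (spectral_radius_ge Ma) schA).
pose B := \sum_(i < \dim (@fullv _ V)) nrm b`_i.
apply: (@squeeze_cvgr _ _ _ _ (fun=> 0) (fun k => rV_l1 (iter k (mulmxr M) v) * B)).
- near=> k; rewrite (nrm_ge0 nrmP) /= {1}(coord_vbasis (memvf (iter k A x))).
  apply: le_trans (nrm_sum nrmP _ _ _) _; rewrite mulr_sumr.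
  apply: ler_sum => i _; rewrite (nrmZ nrmP) ler_wpM2r ?(nrm_ge0 nrmP) //.
  rewrite passmx.coord_rVof /modulus -/b.
  have -> : to_complex (passmx.rVof b (iter k A x) 0 i) = iter k (mulmxr M) v 0 i.
    by rewrite -Mk [RHS]mxE.
  rewrite /rV_l1 (bigD1 i) //= lerDl sumr_ge0 // => j _.
  exact: (modulus_ge0 (K := ComplexScalars) _).
- exact: cvg_cst.
- by rewrite -(mul0r B); exact: cvgMl.
Unshelve. all: by end_near.
Qed.

(** Convergence to 0 on each basis vector is uniform on the unit ball, since
    the norm dominates the coordinates. *)
Lemma schur_power_half (K : scalar_kind) (V : vectType (base_field R K))
    (nrm : V -> R) (A : 'End(V)) :
  is_norm nrm -> schur A ->
  exists2 N, (0 < N)%N & forall x, nrm (iter N A x) <= 2^-1 * nrm x.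
Proof.
move=> nrmP schA; have [C C0 HC] := coord_bound nrmP.
set b := vbasis (@fullv _ V) in HC *.
pose u k := C * \sum_(i < \dim (@fullv _ V)) nrm (iter k A b`_i).
have u0 : u @ \oo --> (0 : R).
  rewrite -(mulr0 C); apply: cvgMr.
  by apply: cvg0_sum => i; exact: schur_iter_cvg0.
have h0 : 0 < 2^-1 :> R by rewrite invr_gt0.
have [N _ HN] := cvg0_near_le u0 h0.
exists N.+1 => // x; have /= uN := HN N.+1 (leqnSn N).
have iter_sum (k : nat) :
    iter k A x = \sum_(i < \dim (@fullv _ V)) coord b i x *: iter k A b`_i.
  elim: k => [|k IH] /=; first exact: coord_vbasis (memvf x).
  by rewrite IH linear_sum; apply: eq_bigr => i _; rewrite linearZ.
rewrite -iterS (iter_sum N.+1); apply: le_trans (nrm_sum nrmP _ _ _) _.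
apply: le_trans (_ : u N.+1 * nrm x <= _); last first.
  by rewrite ler_wpM2r // (nrm_ge0 nrmP).
rewrite /u mulrAC mulr_sumr; apply: ler_sum => i _.
by rewrite (nrmZ nrmP) ler_wpM2r ?(nrm_ge0 nrmP).
Qed.

End SpectralRadius.

(** * Distance to a subspace under a Schur map *)

Section Distance.
Variables (R : realType) (K : scalar_kind) (V : lmodType (base_field R K)).
Variables (nrm : V -> R) (nrmP : is_norm nrm).

(** The norm of the quotient of V by U, pulled back to V. *)
Definition dist_to (U : set V) (x : V) : R := inf [set nrm (x - v) | v in U].

(** Distance at most t, with a witness: unlike an inequality on the infimum,
    it adds up and passes through brackets without any limiting argument. *)
Definition close_to (U : set V) (t : R) (x : V) : Prop :=
  exists2 v, U v & nrm (x - v) <= t.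

Definition is_subspace (U : set V) : Prop :=
  [/\ U 0, forall x y, U x -> U y -> U (x + y) & forall a x, U x -> U (a *: x)].

Variables (U : set V) (subU : is_subspace U).

Lemma close_to_le t t' x : t <= t' -> close_to U t x -> close_to U t' x.
Proof. by move=> tt' [v Uv xv]; exists v => //; exact: le_trans tt'. Qed.

Lemma close_to_mem x : U x -> close_to U 0 x.
Proof. by move=> Ux; exists x; rewrite // subrr (nrm0 nrmP). Qed.

Lemma close_to_nrm x : close_to U (nrm x) x.
Proof. by exists 0; rewrite ?subr0 //; case: subU. Qed.

Lemma close_toD t t' x y :
  close_to U t x -> close_to U t' y -> close_to U (t + t') (x + y).
Proof.
move=> [v Uv xv] [w Uw yw]; exists (v + w); first by case: subU => _ + _; exact.
by rewrite opprD addrACA; apply: le_trans (nrmD nrmP _ _) _; exact: lerD.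
Qed.

Lemma close_toZ t a x : close_to U t x -> close_to U (modulus a * t) (a *: x).
Proof.
move=> [v Uv xv]; exists (a *: v); first by case: subU => _ _; exact.
by rewrite -scalerBr (nrmZ nrmP) ler_wpM2l ?modulus_ge0.
Qed.

Lemma close_toN t x : close_to U t x -> close_to U t (- x).
Proof. by move=> /(close_toZ (-1)); rewrite modulusN1 mul1r scaleN1r. Qed.

Lemma close_to_sum (I : Type) (s : seq I) (P : pred I) (t : I -> R) (E : I -> V) :
  (forall i, P i -> close_to U (t i) (E i)) ->
  close_to U (\sum_(i <- s | P i) t i) (\sum_(i <- s | P i) E i).
Proof.
move=> tE; elim/big_rec2: _ => [|i y x Pi xy]; last exact/close_toD/xy/tE.
by apply: close_to_mem; case: subU.
Qed.

Lemma dist_to_le t x : close_to U t x -> dist_to U x <= t.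
Proof.
move=> [v Uv]; apply: le_trans; apply: ge_inf; last by exists v.
by exists 0 => _ [w _ <-]; exact: nrm_ge0 nrmP _.
Qed.

Lemma dist_to_ge0 x : 0 <= dist_to U x.
Proof.
apply: lb_le_inf; first by exists (nrm (x - 0)), 0 => //; case: subU.
by move=> _ [v _ <-]; exact: nrm_ge0 nrmP _.
Qed.

Lemma close_to_dist_lt t x : dist_to U x < t -> close_to U t x.
Proof.
move=> /inf_lt; case; first by exists (nrm (x - 0)), 0 => //; case: subU.
by move=> _ [v Uv <-] /ltW; exists v.
Qed.

Lemma dist_toD x y : dist_to U (x + y) <= dist_to U x + dist_to U y.
Proof.
apply/ler_addgt0Pr => e e0; rewrite [e]splitr addrACA.
apply: dist_to_le; apply: close_toD; apply: close_to_dist_lt; rewrite ltrDl;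
  exact: divr_gt0.
Qed.

(** A bounded additive map that preserves U up to closure induces on the
    quotient a map with the same bound. *)
Lemma dist_to_map (T : V -> V) (b : R) :
  (forall x y, T (x + y) = T x + T y) -> 0 <= b ->
  (forall x, nrm (T x) <= b * nrm x) -> (forall u, U u -> dist_to U (T u) <= 0) ->
  forall x, dist_to U (T x) <= b * dist_to U x.
Proof.
move=> TD b0 Tb TU x; apply/ler_addgt0Pr => e e0.
have e'0 : 0 < e / (b + 1) by rewrite divr_gt0 // ltr_wpDl.
have [|v Uv xv] := @close_to_dist_lt (dist_to U x + e / (b + 1)) x.
  by rewrite ltrDl.
rewrite -{1}(subrK v x) TD; apply: le_trans (dist_toD _ _) _.
have := TU _ Uv; have : dist_to U (T (x - v)) <= b * nrm (x - v).
  by apply: le_trans (Tb _); apply: dist_to_le; exact: close_to_nrm.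
have : b * nrm (x - v) <= b * (dist_to U x + e / (b + 1)) by rewrite ler_wpM2l.
have : b * (e / (b + 1)) <= e.
  by rewrite mulrA ler_pdivrMr ?ltr_wpDl // mulrC ler_wpM2l ?lerDl // ltW.
by lra.
Qed.

End Distance.

Section SchurDistance.
Variables (R : realType) (K : scalar_kind) (V : vectType (base_field R K)).
Variables (nrm : V -> R) (nrmP : is_norm nrm) (A : 'End(V)) (schA : schur A).
Variables (U : set V) (subU : is_subspace U).
Hypothesis AU : forall u, U u -> dist_to nrm U (A u) <= 0.
Local Notation q := (dist_to nrm U).

Lemma dist_to_iter (a : R) : 0 <= a -> (forall x, nrm (A x) <= a * nrm x) ->
  forall j x, q (iter j A x) <= a ^+ j * q x.
Proof.
move=> a0 Aa; elim=> [|j IH] x; first by rewrite mul1r.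
rewrite iterS exprS -mulrA; apply: le_trans (ler_wpM2l a0 (IH x)).
by apply: dist_to_map => // y z; rewrite linearD.
Qed.

(** Some power N of A halves q; averaging q over the first N iterates of A with
    slowly increasing weights turns this into a contraction in one step. *)
Lemma schur_adapted_dist : exists p : V -> R, exists th : R, exists C : R,
  [/\ 0 <= th < 1, 0 <= C, forall x, q x <= p x <= C * q x,
      forall x, p (A x) <= th * p x & forall x y, p (x + y) <= p x + p y].
Proof.
have [N N0 AN] := schur_power_half nrmP schA.
have [a a0 Aa] := linear_bounded A nrmP.
have qa := dist_to_iter a0 Aa.
have iterD j x y : iter j A (x + y) = iter j A x + iter j A y.
  by elim: j => //= j ->; rewrite linearD.
have qN x : q (iter N A x) <= 2^-1 * q x.
  apply: (dist_to_map nrmP subU (T := iter N A)) => // u Uu.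
  apply: le_trans (qa _ _) _; rewrite (_ : q u = 0) ?mulr0 //.
  apply/eqP; rewrite eq_le (dist_to_ge0 nrmP subU) andbT.
  by apply: (dist_to_le nrmP); exact: close_to_mem.
have q0 x : 0 <= q x := dist_to_ge0 nrmP subU x.
have NR : 1 <= N%:R :> R by rewrite ler1n.
have NR0 : 0 < N%:R :> R by exact: lt_le_trans NR.
(* The weights grow from 1 to less than 2, so that the halving after N steps
   pays for the drop of the weight from the last index to the first. *)
pose w (j : nat) : R := 1 + j%:R / N%:R.
have w1 j : 1 <= w j by rewrite lerDl divr_ge0.
have w0 j : 0 <= w j by exact: le_trans (w1 j).
have wz : w 0%N = 1 by rewrite /w mul0r addr0.
pose p x := \sum_(j < N) w j * q (iter j A x).
pose th : R := 1 - (2 * N%:R)^-1.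
have thN : (2 * N%:R)^-1 <= 1 / 2 :> R.
  by rewrite invfM mul1r ler_piMr ?invf_le1 ?invr_ge0.
exists p, th, (\sum_(j < N) w j * a ^+ j); split.
- apply/andP; split; first by rewrite /th; lra.
  by rewrite /th ltrBlDr ltrDl invr_gt0 mulr_gt0.
- by apply: sumr_ge0 => j _; rewrite mulr_ge0 ?exprn_ge0.
- move=> x; apply/andP; split.
    rewrite /p; case: (N) N0 => // N' _; rewrite big_ord_recl /= wz mul1r.
    by rewrite lerDl; apply: sumr_ge0 => j _; rewrite mulr_ge0.
  by rewrite mulr_suml; apply: ler_sum => j _; rewrite -mulrA ler_wpM2l //.
- move=> x.
  have step j : (j.+1 < N)%N -> w j <= th * w j.+1.
    move=> jN; have j1 : j.+1%:R / N%:R <= 1 :> R.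
      by rewrite ler_pdivrMr // mul1r ler_nat ltnW.
    rewrite /w /th invfM -(@natr1 R j) mulrDl in j1 *.
    set i := N%:R^-1 in j1 *; set y := j%:R * i in j1 *.
    have i0 : 0 <= i by rewrite invr_ge0.
    have : i * (y + 1 * i) <= i * 1 by rewrite ler_wpM2l.
    by lra.
  have last_step : w N.-1 / 2 <= th.
    rewrite /w /th invfM -subn1 natrB // mulrBl mulfV ?gt_eqF //; lra.
  rewrite /p mulr_sumr; case: (N) N0 qN step last_step => // N' _ qN step last_step.
  rewrite big_ord_recr big_ord_recl /= addrC; apply: lerD.
    rewrite -iterSr wz mul1r.
    apply: le_trans (ler_wpM2l _ (qN x)) _; first exact: w0.
    by rewrite mulrA ler_wpM2r.
  apply: ler_sum => j _; rewrite -iterSr mulrA ler_wpM2r //.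
  by apply: step; rewrite ltnS.
- move=> x y; rewrite /p -big_split; apply: ler_sum => j _ /=.
  rewrite -mulrDr ler_wpM2l // iterD.
  exact: dist_toD.
Qed.

Lemma schur_dist_cvg0 (x : nat -> V) (e : nat -> R) :
  e @ \oo --> (0 : R) ->
  (\forall k \near \oo, q (x k.+1 - A (x k)) <= e k * (1 + q (x k))) ->
  (fun k => q (x k)) @ \oo --> (0 : R).
Proof.
move=> e0 xe.
have [p [th [C [th01 C0 qp pA pD]]]] := schur_adapted_dist.
have q0 y : 0 <= q y := dist_to_ge0 nrmP subU y.
have p0 y : 0 <= p y by have /andP[+ _] := qp y; exact: le_trans.
have pcvg : (fun k => p (x k)) @ \oo --> (0 : R).
  apply: (@perturbed_contraction _ _ (fun k => C * `|e k|) th th01) => //.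
    by rewrite -(mulr0 C); apply: cvgMr; rewrite -(normr0 R); exact: cvg_norm.
  near=> k.
  rewrite -{1}(subrK (A (x k)) (x k.+1)) addrC; apply: le_trans (pD _ _) _.
  apply: lerD; first exact: pA.
  have /andP[_] := qp (x k.+1 - A (x k)); move=> /le_trans; apply.
  rewrite -mulrA ler_wpM2l //.
  have : q (x k.+1 - A (x k)) <= e k * (1 + q (x k)) by near: k.
  move=> /le_trans; apply; apply: (@le_trans _ _ (`|e k| * (1 + q (x k)))).
    by rewrite ler_wpM2r ?addr_ge0 // ler_norm.
  by rewrite ler_wpM2l // lerD2l; case/andP: (qp (x k)).
apply: (@squeeze_cvgr _ _ _ _ (fun=> 0) (fun k => p (x k))) => //.
  by near=> k; rewrite q0 /=; case/andP: (qp (x k)).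
exact: cvg_cst.
Unshelve. all: by end_near.
Qed.

End SchurDistance.

(** * Lower central series and words *)

Section LieBasics.
Variables (F : fieldType) (g : vectType F) (br : g -> g -> g).
Hypothesis brP : is_lie_bracket br.

Lemma brDl x y z : br (x + y) z = br x z + br y z.
Proof. by case: brP => H _ _ _; have := H 1 x y z; rewrite !scale1r. Qed.

Lemma brDr x y z : br x (y + z) = br x y + br x z.
Proof. by case: brP => _ H _ _; have := H 1 x y z; rewrite !scale1r. Qed.

Lemma br0l z : br 0 z = 0.
Proof. by apply: (addrI (br 0 z)); rewrite -brDl !addr0. Qed.

Lemma br0r z : br z 0 = 0.
Proof. by apply: (addrI (br z 0)); rewrite -brDr !addr0. Qed.

Lemma brZl a x z : br (a *: x) z = a *: br x z.
Proof. by case: brP => H _ _ _; have := H a x 0 z; rewrite br0l !addr0. Qed.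

Lemma brZr a x z : br z (a *: x) = a *: br z x.
Proof. by case: brP => _ H _ _; have := H a z x 0; rewrite br0r !addr0. Qed.

Lemma brNl x z : br (- x) z = - br x z.
Proof. by rewrite -scaleN1r brZl scaleN1r. Qed.

Lemma brNr x z : br z (- x) = - br z x.
Proof. by rewrite -scaleN1r brZr scaleN1r. Qed.

Lemma brC x y : br x y = - br y x.
Proof.
case: brP => _ _ H _; apply/eqP; rewrite -addr_eq0; apply/eqP.
by have := H (x + y); rewrite brDl !brDr !H add0r addr0.
Qed.

Lemma br_jacobi x y z : br x (br y z) = br (br x y) z + br y (br x z).
Proof.
case: brP => _ _ _ /(_ x y z) /eqP.
rewrite -addrA addr_eq0 => /eqP ->.
by rewrite opprD -brNr -(brC x z) -(brC (br x y) z) addrC.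
Qed.

Lemma br_suml (I : Type) (s : seq I) (E : I -> g) z :
  br (\sum_(i <- s) E i) z = \sum_(i <- s) br (E i) z.
Proof. by apply: (big_morph (br^~ z)) => [x y|]; rewrite ?brDl ?br0l. Qed.

Lemma br_sumr (I : Type) (s : seq I) (E : I -> g) z :
  br z (\sum_(i <- s) E i) = \sum_(i <- s) br z (E i).
Proof. by apply: (big_morph (br z)) => [x y|]; rewrite ?brDr ?br0r. Qed.

Lemma mem_lie_prod (U V : {vspace g}) u v :
  u \in U -> v \in V -> br u v \in lie_prod br U V.
Proof.
move=> /coord_vbasis -> /coord_vbasis ->.
rewrite br_suml; apply: memv_suml => i _; rewrite br_sumr.
apply: memv_suml => j _; rewrite brZl brZr !memvZ //.
by apply/memv_span/allpairs_f; apply: mem_nth; rewrite size_tuple.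
Qed.

Lemma lie_prod_sub (U V W : {vspace g}) :
  (forall u v, u \in U -> v \in V -> br u v \in W) -> (lie_prod br U V <= W)%VS.
Proof.
move=> UVW; apply/span_subvP => _ /allpairsP[[u v] /= [uU vV ->]].
by apply: UVW; exact: vbasis_mem.
Qed.

(** By the Jacobi identity, ad x is a derivation of the bracket. *)
Lemma lie_prod_ideal (U V : {vspace g}) :
  lie_ideal br U -> lie_ideal br V -> lie_ideal br (lie_prod br U V).
Proof.
move=> iU iV x y; rewrite /lie_prod; set s := (X in <<X>>%VS) => ys.
rewrite (coord_span (X := in_tuple s) ys) br_sumr; apply: memv_suml => i _.
rewrite brZr memvZ //.
have : (in_tuple s)`_i \in s by rewrite mem_nth.
move=> /allpairsP[[u v] /= [/vbasis_mem uU /vbasis_mem vV ->]].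
rewrite br_jacobi -/(lie_prod br U V).
by apply: memvD; apply: mem_lie_prod => //; [exact: iU|exact: iV].
Qed.

Variables (h : {vspace g}) (hI : lie_ideal br h).

Lemma lower_central_ideal i : lie_ideal br (lower_central br h i).
Proof.
rewrite /lower_central; elim: i.-1 => //= j IH; exact: lie_prod_ideal.
Qed.

Lemma lower_centralS i : (0 < i)%N ->
  lower_central br h i.+1 = lie_prod br (lower_central br h i) h.
Proof. by case: i. Qed.

Lemma lower_central_sub i : (lower_central br h i <= h)%VS.
Proof.
rewrite /lower_central; elim: i.-1 => //= j IH.
by apply: lie_prod_sub => u v _ vh; exact: hI.
Qed.

Variables n r : nat.
Implicit Types Y Z : letter n r -> g.

(** Words descend to the quotient of g by an ideal. *)
Lemma word_val_congr (I : {vspace g}) Y Z w : lie_ideal br I ->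
  (forall a, Y a - Z a \in I) -> word_val br Y w - word_val br Z w \in I.
Proof.
move=> iI YZ; elim: w => [|a [|b w] IH]; first by rewrite subrr mem0v.
  exact: YZ.
rewrite [word_val _ _ _]/= -/(word_val br Y (b :: w)) [X in _ - X]/=.
rewrite -/(word_val br Z (b :: w)).
set y := word_val br Y _ in IH *; set z := word_val br Z _ in IH *.
rewrite (_ : _ - _ = br (Y a) (y - z) + br (Y a - Z a) z).
  rewrite memvD //; first exact: iI.
  by rewrite brC memvN iI.
by rewrite brDr brDl brNr brNl addrA subrK.
Qed.

End LieBasics.

Section WordNorms.
Variables (R : realType) (K : scalar_kind) (g : vectType (base_field R K)).
Variables (br : g -> g -> g) (nrm : g -> R) (mu : R).
Hypotheses (brP : is_lie_bracket br) (nrmP : is_norm nrm) (mu0 : 0 <= mu).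
Hypothesis br_mu : forall x y, nrm (br x y) <= mu * nrm x * nrm y.
Variables n r : nat.
Implicit Types Y Z : letter n r -> g.

Lemma word_val_norm Y a w :
  nrm (word_val br Y (a :: w)) <= mu ^+ size w * \prod_(b <- a :: w) nrm (Y b).
Proof.
elim: w a => [|b w IH] a; first by rewrite /= expr0 mul1r big_seq1.
rewrite [word_val _ _ _]/= -/(word_val br Y (b :: w)) [size _]/=.
apply: le_trans (br_mu _ _) _; rewrite big_cons exprS -!mulrA ler_wpM2l //.
by rewrite mulrCA ler_wpM2l // (nrm_ge0 nrmP).
Qed.

Local Notation close h := (close_to nrm [set x | x \in h]).

Lemma subspace_vspace (h : {vspace g}) : is_subspace [set x | x \in h].
Proof.
by split => [|x y|a x] /=; [exact: mem0v|exact: memvD|exact: memvZ].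
Qed.

Variables (h I J : {vspace g}).
Hypotheses (commh : forall x y, br x y \in h) (Ih : (I <= h)%VS).
Hypotheses (iI : lie_ideal br I) (iJ : lie_ideal br J).
Hypothesis IhJ : forall u v, u \in I -> v \in h -> br u v \in J.

(** On I modulo J the operator ad x only depends on x modulo h, since h sends I
    into J; hence the distance from x to h, not the norm of x, bounds it. *)
Lemma br_close s t x u : u \in I -> close h s x -> close J t u ->
  close J (mu * s * t) (br x u).
Proof.
move=> uI [v /= vh xv] [z /= zJ uz]; exists (br (x - v) z + br v u).
  by apply: memvD; [exact: iJ|rewrite (brC brP) memvN; exact: IhJ].
have -> : br x u = br (x - v) (u - z) + (br (x - v) z + br v u).
  by rewrite addrA -(brDr brP) subrK -(brDl brP) subrK.
rewrite addrK; apply: le_trans (br_mu _ _) _.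
by rewrite ler_pM ?mulr_ge0 ?(nrm_ge0 nrmP) // ler_wpM2l.
Qed.

(** The key estimate.  Write a word of length at least 2 as [Y a + H a, y + d],
    where y is the value of the tail at Y and d, which lies in I, is the change
    of that tail.  Its change is
       [Y a, d] + [H a, y] + [H a, d].
    The last term is in J because d is in h.  So is the second one when the tail
    has two letters or more, because y is then a commutator, hence in h.
    Only [Y a, d] propagates, with a factor mu eps by br_close; the factor 2
    comes from the innermost bracket, where [H a, Y b] also counts. *)
Lemma word_val_shift_close Y H eps G w :
  (forall a, close h eps (Y a)) -> (forall a, H a \in I) ->
  (forall a, close J G (H a)) -> w != [::] ->
  close J (if w is [:: _] then G else 2 * (mu * eps) ^+ (size w).-1 * G)
    (word_val br (fun a => Y a + H a) w - word_val br Y w).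
Proof.
move=> Yh HI HJ; elim: w => // a [|b w] IH _.
  by rewrite /= addrC addrA addNr add0r.
have dI : word_val br (fun a => Y a + H a) (b :: w) - word_val br Y (b :: w) \in I.
  by apply: word_val_congr => // c; rewrite addrC addrA addNr add0r.
have {IH} dJ := IH isT.
have E Z : word_val br Z [:: a, b & w] = br (Z a) (word_val br Z (b :: w)) by [].
rewrite !E; set y := word_val br Y _ in dI dJ *.
set y' := word_val br _ _ in dI dJ *.
have -> : br (Y a + H a) y' - br (Y a) y =
    br (Y a) (y' - y) + br (H a) y + br (H a) (y' - y).
  by rewrite -addrA -(brDr brP (H a)) [y + _]addrC subrK (brDl brP)
    (brDr brP) (brNr brP) addrAC.
have HdJ : br (H a) (y' - y) \in J by apply: IhJ => //; exact: subvP Ih _ dI.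
have T1 := close_to_mem nrmP (U := [set x | x \in J]) HdJ.
have T2 : close J (if w is [::] then mu * eps * G else 0) (br (H a) y).
  rewrite /y; case: (w) => [|b' w'].
    rewrite (brC brP).
    by apply: (close_toN nrmP (subspace_vspace J));
      exact: br_close (HI a) (Yh b) (HJ a).
  by apply: (close_to_mem nrmP); apply: IhJ => //; exact: commh.
have subJ := subspace_vspace J.
have := close_toD nrmP subJ (close_toD nrmP subJ (br_close dI (Yh a) dJ) T2) T1.
apply: close_to_le; case: (w) => [|b' w'] /=; first by rewrite expr1; lra.
by rewrite !addr0 [in leRHS]exprS; set P := (_ * _) ^+ _; lra.
Qed.

End WordNorms.

(** * Cartesian powers and majorant series *)

Section Powers.
Variables (R : realType) (K : scalar_kind) (g : vectType (base_field R K)).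
Variables (nrm : g -> R) (nrmP : is_norm nrm).
Local Notation close h := (close_to nrm [set x | x \in h]).

Lemma sum_norm_is_norm m : is_norm (sum_norm nrm (m := m)).
Proof.
split.
- by move=> X; apply: sumr_ge0 => j _; exact: nrm_ge0 nrmP _.
- move=> X /eqP; rewrite psumr_eq0 => [/allP X0|j _]; last exact: nrm_ge0 nrmP _.
  apply/ffunP => j; rewrite ffunE; apply: (nrm_eq0 nrmP); apply/eqP/X0.
  by rewrite mem_index_enum.
- move=> a X; rewrite mulr_sumr; apply: eq_bigr => j _.
  by rewrite ffunE (nrmZ nrmP).
- move=> X Y; rewrite -big_split; apply: ler_sum => j _ /=.
  by rewrite ffunE (nrmD nrmP).
Qed.

Lemma nrm_le_sum_norm m (X : {ffun 'I_m -> g}) j : nrm (X j) <= sum_norm nrm X.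
Proof.
rewrite /sum_norm (bigD1 j) //= lerDl; apply: sumr_ge0 => i _.
exact: nrm_ge0 nrmP _.
Qed.

Definition vspace_pow m (h : {vspace g}) : set {ffun 'I_m -> g} :=
  [set X | forall j, X j \in h].

Lemma vspace_pow_subspace m h : is_subspace (@vspace_pow m h).
Proof.
split => [j|X Y hX hY j|a X hX j]; rewrite ffunE ?mem0v //.
  by rewrite memvD.
by rewrite memvZ.
Qed.

Lemma close_to_dist_pow_lt m (h : {vspace g}) t (X : {ffun 'I_m -> g}) j :
  dist_pow nrm h X < t -> close h t (X j).
Proof.
move=> /(close_to_dist_lt (vspace_pow_subspace m h)) [Y hY XY].
exists (Y j); first exact: hY.
apply: le_trans XY; have := nrm_le_sum_norm (X - Y) j.
by rewrite !ffunE.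
Qed.

Lemma dist_pow_le m (h : {vspace g}) t (X : {ffun 'I_m -> g}) :
  (forall j, close h t (X j)) -> dist_pow nrm h X <= m%:R * t.
Proof.
move=> /fin_all_exists2[v hv Xv].
apply: (dist_to_le (sum_norm_is_norm m)); exists [ffun j => v j].
  by move=> j; rewrite ffunE hv.
rewrite /sum_norm -[m in m%:R]card_ord mulr_natl -sumr_const.
by apply: ler_sum => j _; rewrite !ffunE.
Qed.

Lemma dist_pow_ge0 m (h : {vspace g}) (X : {ffun 'I_m -> g}) : 0 <= dist_pow nrm h X.
Proof.
exact: dist_to_ge0 (sum_norm_is_norm m) _ (vspace_pow_subspace m h) _.
Qed.

Lemma dist_pow_le0 m (h : {vspace g}) (X : {ffun 'I_m -> g}) :
  (forall e, 0 < e -> forall j, close h e (X j)) -> dist_pow nrm h X <= 0.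
Proof.
move=> Xh; apply/ler_addgt0Pr => e e0; rewrite add0r.
apply: le_trans (dist_pow_le (Xh (e / m.+1%:R) _)) _; first exact: divr_gt0.
rewrite mulrA ler_pdivrMr // mulrC ler_wpM2l ?ler_nat //; exact: ltW.
Qed.

Lemma sum_norm_dist_pow0 m (X : {ffun 'I_m -> g}) :
  sum_norm nrm X <= dist_pow nrm 0%VS X.
Proof.
apply/ler_addgt0Pr => e e0.
have : dist_to (sum_norm nrm (m := m)) (vspace_pow 0%VS) X < dist_pow nrm 0%VS X + e.
  by rewrite ltrDl.
move=> /(close_to_dist_lt (vspace_pow_subspace m 0%VS))[Y Y0].
rewrite (_ : Y = 0) ?subr0 //; apply/ffunP => j; rewrite ffunE.
by apply/eqP; rewrite -memv0 Y0.
Qed.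

End Powers.

(** The words of length less than N, listed through the finite type of pairs of
    a length and a tuple, are pairwise distinct, so that a partial sum of the
    series is a finite subsum of the unordered sum. *)
Lemma sum_words_le_esum (R : realType) (T : finType) (P : pred (seq T))
    (a : seq T -> R) (N : nat) :
  (forall w, 0 <= a w) ->
  ((\sum_(l < N) \sum_(w : l.-tuple T | P w) a w)%:E <=
   \esum_(w in [set w | P w]) (a w)%:E)%E.
Proof.
move=> a0; pose I := {l : 'I_N & l.-tuple T}.
pose val_word (p : I) : seq T := tagged p.
have val_inj : injective val_word.
  move=> [l t] [l' t'] tt'; have {}tt' : tval t = tval t' := tt'.
  have ll' : l = l'.
    by apply/val_inj; rewrite /= -(size_tuple t) -(size_tuple t') tt'.
  by case: _ / ll' t' tt' => t' /val_inj ->.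
pose s := [seq val_word p | p <- [seq p <- enum {: I} | P (val_word p)]].
apply: esum_ge; exists [set` s].
  split; first exact: finite_seq.
  by move=> w /= /mapP[p]; rewrite mem_filter => /andP[Pp _] ->.
rewrite -fsbig_seq; last by rewrite map_inj_uniq // filter_uniq // enum_uniq.
rewrite big_map big_filter sumEFin lee_fin.
rewrite (sig_big_dep (fun _ => true) (fun (l : 'I_N) (t : l.-tuple T) => P t)
  (fun (l : 'I_N) (t : l.-tuple T) => a t)) /=.
by rewrite big_enum_cond.
Qed.

Section Series.
Variables (R : realType) (K : scalar_kind) (g : vectType (base_field R K)).
Variables (br : g -> g -> g) (nrm : g -> R) (mu : R).
Hypotheses (nrmP : is_norm nrm) (mu0 : 0 <= mu).
Variables (n r : nat) (c : seq (letter n r) -> {ffun 'I_n -> base_field R K}).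

(** Evaluating the class A condition where all letters have the same small norm
    d turns it into the summability of a numerical series. *)
Lemma class_A_majorant (v : g) : v != 0 -> class_A nrm mu c ->
  exists2 d, 0 < d & exists2 S, 0 <= S & forall N i,
    \sum_(l < N) \sum_(w : l.-tuple (letter n r) | series_word w)
      modulus (c w i) * (mu ^+ (size w).-1 * d ^+ size w) <= S.
Proof.
move=> v0 cA; have /fin_all_exists2[e e0 He] := cA.
pose eps := \big[Num.min/1]_i e i.
have eps0 : 0 < eps by apply: lt_bigmin.
pose d := eps / (n + r).+1%:R.
have d0 : 0 < d by rewrite divr_gt0.
have nv : 0 < nrm v.
  rewrite lt_neqAle (nrm_ge0 nrmP) andbT eq_sym.
  by apply: contra v0 => /eqP/(nrm_eq0 nrmP) ->.
(* Its (n + r) copies have total norm less than eps. *)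
pose v' := of_real K (d / nrm v) *: v.
have nv' : nrm v' = d.
  rewrite (nrmZ nrmP) modulus_of_real ger0_norm ?divr_ge0 // ?ltW //.
  by rewrite divfK // gt_eqF.
pose X : {ffun 'I_n -> g} := [ffun=> v'].
pose W : {ffun 'I_r -> g} := [ffun=> v'].
have XW a : nrm (letter_val X W a) = d by case: a => j; rewrite /= ffunE.
have small i : sum_norm nrm X + sum_norm nrm W < e i.
  apply: (@lt_le_trans _ _ eps); last exact: bigmin_le_cond.
  rewrite /sum_norm; under eq_bigr do rewrite ffunE nv'.
  under [X in _ + X]eq_bigr do rewrite ffunE nv'.
  rewrite !sumr_const !card_ord -mulrnDr -mulr_natr /d mulrAC ltr_pdivrMr //.
  by rewrite ltr_pM2l // ltr_nat.
pose a i w := mu ^+ (size w).-1 * modulus (c w i) *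
  \prod_(a <- w) nrm (letter_val X W a).
have a0 i w : 0 <= a i w.
  rewrite /a !mulr_ge0 ?exprn_ge0 ?modulus_ge0 //.
  by apply: prodr_ge0 => b _; exact: nrm_ge0 nrmP _.
pose s i := (\esum_(w in [set w | series_word w]) (a i w)%:E)%E.
have s0 i : (0 <= s i)%E by apply: esum_ge0 => w _; rewrite lee_fin.
have sfin i : s i \is a fin_num.
  by rewrite ge0_fin_numE //; exact: He (small i).
exists d => //; exists (\sum_i fine (s i)).
  by apply: sumr_ge0 => i _; exact: fine_ge0.
move=> N i; rewrite (bigD1 i) //=; apply: le_trans (_ : fine (s i) <= _); last first.
  by rewrite lerDl; apply: sumr_ge0 => j _; exact: fine_ge0.
rewrite -lee_fin fineK //.
apply: le_trans (sum_words_le_esum _ N (a0 i)).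
rewrite lee_fin le_eqVlt; apply/orP; left; apply/eqP.
apply: eq_bigr => l _; apply: eq_bigr => w _.
rewrite /a (eq_bigr (fun=> d)); last by move=> b _; exact: XW.
by rewrite big_const_seq count_predT iter_mulr_1 mulrCA mulrA.
Qed.

End Series.

(** * The nonlinear part of the dynamics *)

Section Dynamics.
Variables (R : realType) (K : scalar_kind) (g : vectType (base_field R K)).
Variables (br : g -> g -> g) (nrm : g -> R) (mu : R).
Hypotheses (brP : is_lie_bracket br) (nrmP : is_norm nrm) (mu0 : 0 <= mu).
Hypothesis br_mu : forall x y, nrm (br x y) <= mu * nrm x * nrm y.
Variables (n r : nat).
Variables (f : {ffun 'I_n -> g} -> {ffun 'I_r -> g} -> {ffun 'I_n -> g}).
Variables (A : 'End({ffun 'I_n -> g})).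
Variables (c : seq (letter n r) -> {ffun 'I_n -> base_field R K}).
Hypothesis fA : lie_function br nrm f A c.
Hypothesis f0 : forall W, f 0 W = 0.
Variables (d S : R).
Hypotheses (d0 : 0 < d) (S0 : 0 <= S).
Hypothesis cS : forall N i,
  \sum_(l < N) \sum_(w : l.-tuple (letter n r) | series_word w)
    modulus (c w i) * (mu ^+ (size w).-1 * d ^+ size w) <= S.

Local Notation close h := (close_to nrm [set x | x \in h]).
Local Notation word X W w := (word_val br (letter_val X W) w).

Implicit Types (X Y : {ffun 'I_n -> g}) (W : {ffun 'I_r -> g}).

Definition nonlinear_part X W := f X W - A X.

Lemma nonlinear_part0 W : nonlinear_part 0 W = 0.
Proof. by rewrite /nonlinear_part f0 linear0 subrr. Qed.

(** A termwise comparison of the two series, with kappa as the gain over the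
    majorant series.  The slack eta absorbs the passage to the limit: the
    series converges to f everywhere, but absolute convergence is only used for
    the terms compared here. *)
Lemma nonlinear_part_close (J : {vspace g}) (kappa : R) X Y W :
  0 <= kappa ->
  (forall w, series_word w ->
    close J (mu ^+ (size w).-1 * d ^+ size w * kappa) (word X W w - word Y W w)) ->
  forall eta, 0 < eta -> forall j,
    close J (S * kappa + eta) ((nonlinear_part X W - nonlinear_part Y W) j).
Proof.
move=> k0 XY eta eta0 j; have subJ := subspace_vspace J.
have eta2 : 0 < eta / 2 by rewrite divr_gt0.
have [N [XN YN]] : exists N,
    sum_norm nrm (f X W - (A X + word_sum br c X W N)) <= eta / 2 /\
    sum_norm nrm (f Y W - (A Y + word_sum br c Y W N)) <= eta / 2.
  have [N _ HN] : \forall N \near \oo,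
      sum_norm nrm (f X W - (A X + word_sum br c X W N)) <= eta / 2 /\
      sum_norm nrm (f Y W - (A Y + word_sum br c Y W N)) <= eta / 2.
    by apply: filterS2 (cvg0_near_le (fA X W) eta2) (cvg0_near_le (fA Y W) eta2).
  by exists N; apply: HN => /=.
set TX := f X W - _ in XN; set TY := f Y W - _ in YN.
have -> : nonlinear_part X W - nonlinear_part Y W =
    word_sum br c X W N - word_sum br c Y W N + (TX - TY).
  have -> : TX = nonlinear_part X W - word_sum br c X W N.
    by rewrite /TX opprD addrA.
  have -> : TY = nonlinear_part Y W - word_sum br c Y W N.
    by rewrite /TY opprD addrA.
  by rewrite [RHS]addrC addrACA subrK -opprD subrK.
rewrite ffunE; apply: (close_toD nrmP subJ).
  rewrite !ffunE -sumrB.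
  under eq_bigr do rewrite -sumrB.
  apply: close_to_le (ler_wpM2r k0 (cS N j)) _.
  rewrite mulr_suml; apply: (close_to_sum nrmP subJ) => l _.
  rewrite mulr_suml; apply: (close_to_sum nrmP subJ) => w sw.
  by rewrite -scalerBr -mulrA; apply: (close_toZ nrmP subJ); exact: XY.
apply: close_to_le (close_to_nrm nrm subJ _).
have := nrm_le_sum_norm nrmP TX j; have := nrm_le_sum_norm nrmP TY j.
have -> : (TX - TY) j = TX j - TY j by rewrite !ffunE.
by have := nrmB nrmP (TX j) (TY j); lra.
Qed.

(** Words without state letters cancel in any difference. *)
Lemma word_val_inr X Y W (w : seq (letter n r)) :
  (forall i, inl i \notin w) -> word X W w = word Y W w.
Proof.
elim: w => // a [|b w] IH nl.
  by case: a nl => // i /(_ i); rewrite inE eqxx.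
have E Z : word Z W [:: a, b & w] = br (letter_val Z W a) (word Z W (b :: w)) by [].
rewrite !E IH => [|i]; last by have := nl i; rewrite in_cons negb_or => /andP[].
by case: a nl {E} => // i /(_ i); rewrite in_cons eqxx.
Qed.

Lemma word_inl_norm X W i eps (w : seq (letter n r)) :
  0 <= eps <= d -> (forall j, nrm (X j) <= eps) -> (forall j, nrm (W j) <= d) ->
  inl i \in w ->
  nrm (word X W w) <= mu ^+ (size w).-1 * d ^+ size w * (eps / d).
Proof.
move=> /andP[e0 ed] Xe Wd iw.
have letd a : 0 <= nrm (letter_val X W a) <= d.
  rewrite (nrm_ge0 nrmP); case: a => j /=; last exact: Wd.
  exact: le_trans (Xe j) ed.
have prod_le s : \prod_(a <- s) nrm (letter_val X W a) <= d ^+ size s.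
  elim: s => [|a s IH]; first by rewrite big_nil.
  rewrite big_cons exprS; case/andP: (letd a) => a0 ad.
  by apply: ler_pM => //; apply: prodr_ge0 => b _; case/andP: (letd b).
case: w iw => // a w iw; apply: le_trans (word_val_norm nrmP mu0 br_mu _ _ _) _.
rewrite -mulrA /= ler_wpM2l ?exprn_ge0 // (big_rem _ iw).
have -> : d ^+ (size w).+1 * (eps / d) = eps * d ^+ size w.
  by rewrite exprS; field; rewrite gt_eqF.
apply: ler_pM => //; first exact: nrm_ge0 nrmP _.
  by apply: prodr_ge0 => b _; case/andP: (letd b).
  exact: Xe.
by apply: le_trans (prod_le _) _; rewrite size_rem.
Qed.

(** Comparison with the state 0, where only the words with a state letter
    remain and one of their letters is at most eps. *)
Lemma nonlinear_part_small (J : {vspace g}) eps X W :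
  0 <= eps <= d -> (forall j, nrm (X j) <= eps) -> (forall j, nrm (W j) <= d) ->
  forall eta, 0 < eta -> forall j,
    close J (S * (eps / d) + eta) (nonlinear_part X W j).
Proof.
move=> ed Xe Wd eta eta0 j; have subJ := subspace_vspace J.
rewrite -[nonlinear_part X W]subr0 -(nonlinear_part0 W).
apply: nonlinear_part_close => // [|w _].
  by case/andP: ed => e0 _; rewrite divr_ge0 // ltW.
have [/existsP[i iw]|] := boolP [exists i, inl i \in w]; last first.
  rewrite negb_exists => /forallP nl; rewrite (word_val_inr X 0 W nl) subrr.
  apply: close_to_le (close_to_mem nrmP _); last exact: mem0v.
  case/andP: ed => e0 _.
  by rewrite !mulr_ge0 ?exprn_ge0 ?invr_ge0 // ltW.
apply: close_to_le (close_to_nrm nrm subJ _).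
apply: le_trans (nrmB nrmP _ _) _; rewrite -[leRHS]addr0; apply: lerD.
  exact: word_inl_norm iw.
have := @word_inl_norm 0 W i 0 w; rewrite lexx (ltW d0) mul0r mulr0; apply => //.
by move=> k; rewrite ffunE (nrm0 nrmP).
Qed.

Variable h : {vspace g}.
Hypothesis commh : forall x y, br x y \in h.

(** Words of length at least 2 are commutators, and the single letters W cancel
    against those of the state 0. *)
Lemma nonlinear_part_close_commutator X W eta : 0 < eta ->
  forall j, close h eta (nonlinear_part X W j).
Proof.
move=> eta0 j; rewrite -[nonlinear_part X W]subr0 -(nonlinear_part0 W).
rewrite -[eta]add0r -(mulr0 S).
apply: nonlinear_part_close => // w sw; rewrite mulr0; apply: (close_to_mem nrmP).
case: w sw => // a [|b w] /=; first by case: a => // k _; rewrite subrr mem0v.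
by move=> _; rewrite memvB // commh.
Qed.

Lemma nonlinear_part_close_ideal (I : {vspace g}) X W eta : lie_ideal br I ->
  (forall j, X j \in I) -> 0 < eta -> forall j, close I eta (nonlinear_part X W j).
Proof.
move=> iI XI eta0 j; rewrite -[nonlinear_part X W]subr0 -(nonlinear_part0 W).
rewrite -[eta]add0r -(mulr0 S).
apply: nonlinear_part_close => // w sw; rewrite mulr0; apply: (close_to_mem nrmP).
apply: (word_val_congr brP) => // -[i|i] /=; last by rewrite subrr mem0v.
by rewrite ffunE subr0.
Qed.

Variables (I J : {vspace g}).
Hypotheses (Ih : (I <= h)%VS) (iI : lie_ideal br I) (iJ : lie_ideal br J).
Hypothesis IhJ : forall u v, u \in I -> v \in h -> br u v \in J.

(** The state is split as E + u with u in I: passing from E to E + u changes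
    every word by the amount that word_val_shift_close controls, and the
    nonlinear part at E is small. *)
Lemma nonlinear_part_close_step eps G X W :
  0 < eps <= d -> 0 <= G ->
  (forall j, close I eps (X j)) -> (forall j, close J G (X j)) ->
  (forall j, close h eps (W j)) -> (forall j, nrm (W j) <= d) ->
  forall j, close J (S * (2 * (G + eps) * eps / d ^+ 2) + S * (eps / d) + eps)
    (nonlinear_part X W j).
Proof.
move=> /andP[e0 ed] G0 XI XJ Wh Wd j; have subJ := subspace_vspace J.
have /fin_all_exists2[u uI Xu] := XI.
pose E : {ffun 'I_n -> g} := [ffun j => X j - u j].
have EE k : nrm (E k) <= eps by rewrite ffunE; exact: Xu.
pose H (a : letter n r) : g := match a with inl i => u i | inr _ => 0 end.
have YH : letter_val X W = fun a => letter_val E W a + H a.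
  by apply/funext => -[i|i] /=; rewrite ?ffunE ?subrK ?addr0.
have e2 : 0 < eps / 2 by rewrite divr_gt0.
rewrite -(subrK (nonlinear_part E W) (nonlinear_part X W)) ffunE.
rewrite [X in close_to _ _ (_ + X)]splitr addrACA.
apply: (close_toD nrmP subJ); last by apply: nonlinear_part_small; rewrite ?(ltW e0).
apply: nonlinear_part_close => // [|w sw].
  by rewrite divr_ge0 ?exprn_ge0 ?mulr_ge0 ?addr_ge0 // ltW.
have w0 : w != [::] by case: w sw.
have Yh a : close h eps (letter_val E W a).
  case: a => i /=; last exact: Wh.
  exact: close_to_le (EE i) (close_to_nrm nrm (subspace_vspace h) _).
have HI a : H a \in I by case: a => i /=; rewrite ?mem0v //; exact: uI.
have HJ a : close J (G + eps) (H a).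
  case: a => i /=; last first.
    by apply: close_to_le (close_to_mem nrmP _); [rewrite addr_ge0 // ltW|exact: mem0v].
  rewrite (_ : u i = X i - E i); last by rewrite ffunE opprB addrC subrK.
  apply: (close_toD nrmP subJ) => //; apply: close_to_le (close_to_nrm nrm subJ _).
  by rewrite (nrmN nrmP).
have := word_val_shift_close brP nrmP mu0 br_mu commh Ih iI iJ IhJ Yh HI HJ w0.
rewrite -YH; case: w sw {w0} => // a [|b w] sw.
  case: a sw => // i _ _; rewrite /= subrr; apply: close_to_le (close_to_mem nrmP _).
    by rewrite !mulr_ge0 ?invr_ge0 ?exprn_ge0 ?addr_ge0 // ltW.
  exact: mem0v.
apply: close_to_le; rewrite /= exprMn.
(* As eps <= d, one power of eps is kept as a gain and the other ones are
   absorbed into the majorant series. *)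
have -> : mu ^+ (size w).+1 * d ^+ (size w).+2 * (2 * (G + eps) * eps / d ^+ 2) =
    2 * (mu ^+ (size w).+1 * (d ^+ size w * eps)) * (G + eps).
  by rewrite !exprSr; field; rewrite gt_eqF.
rewrite ler_wpM2r ?addr_ge0 ?(ltW e0) // ler_wpM2l // ler_wpM2l ?exprn_ge0 //.
by rewrite exprSr ler_wpM2r ?(ltW e0) // lerXn2r ?nnegrE ?(ltW e0) ?(ltW d0).
Qed.

(** The nonlinear part is a perturbation modulo J of size eps, relative to the
    size of the state modulo J. *)
Lemma dist_pow_step eps X W :
  0 < eps <= d -> (forall j, close I eps (X j)) ->
  (forall j, close h eps (W j)) -> (forall j, nrm (W j) <= d) ->
  dist_pow nrm J (nonlinear_part X W) <=
  n%:R * (S * 2 / d ^+ 2 * (1 + 2 * d) + S / d + 1) * eps *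
    (1 + dist_pow nrm J X).
Proof.
move=> /andP[e0 ed] XI Wh Wd; set D := dist_pow nrm J X.
have D0 : 0 <= D := dist_pow_ge0 nrmP J X.
have XJ j : close J (D + eps) (X j).
  by apply: (close_to_dist_pow_lt nrmP); rewrite ltrDl.
have De0 : 0 <= D + eps by rewrite addr_ge0 // ltW.
have e01 : 0 < eps <= d by rewrite e0.
apply: le_trans (dist_pow_le nrmP (nonlinear_part_close_step e01 De0 XI XJ Wh Wd)) _.
rewrite -!mulrA ler_wpM2l //.
set i := d^-1; have i0 : 0 <= i by rewrite invr_ge0 ltW.
have -> : (d ^+ 2)^-1 = i * i by rewrite expr2 invfM.
set T := S * (i * i); have T0 : 0 <= T by rewrite !mulr_ge0.
have Ti0 : 0 <= S * i by rewrite mulr_ge0.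
have ineq : 2 * (D + eps + eps) <= 2 * (1 + 2 * d) * (1 + D).
  have : 0 <= d * D by rewrite mulr_ge0 // ltW.
  by lra.
have {ineq}: T * eps * (2 * (D + eps + eps)) <=
    T * eps * (2 * (1 + 2 * d) * (1 + D)).
  by rewrite ler_wpM2l // mulr_ge0 // ltW.
have : 0 <= (S * i + 1) * eps * D.
  by rewrite !mulr_ge0 ?addr_ge0 // ltW.
rewrite /T; lra.
Qed.
End Dynamics.

(** * Global attractivity *)

Lemma limn_esup_near_le (R : realType) (u : nat -> R) (b b' : R) :
  (limn_esup (fun k => (u k)%:E) <= b%:E)%E -> b < b' ->
  \forall k \near \oo, u k <= b'.
Proof.
move=> ub bb'; have : (limn_esup (fun k => (u k)%:E) < b'%:E)%E.
  by apply: le_lt_trans ub _; rewrite lte_fin.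
move=> /ereal_inf_lt[_ [V FV <-] supV]; apply: filterS FV => k Vk.
rewrite -lee_fin; apply: le_trans (ltW supV).
by apply: ereal_sup_ubound; exists k.
Qed.

Theorem theorem5p1 (R : realType) (K : scalar_kind)
    (g : vectType (base_field R K)) (br : g -> g -> g) (nrm : g -> R) (mu : R)
    (n r : nat)
    (f : {ffun 'I_n -> g} -> {ffun 'I_r -> g} -> {ffun 'I_n -> g})
    (A : 'End({ffun 'I_n -> g}))
    (c : seq (letter n r) -> {ffun 'I_n -> base_field R K})
    (h : {vspace g}) :
  is_lie_bracket br ->
  solvable_lie br ->
  is_norm nrm ->
  0 <= mu <= 2 ->
  (forall x y, nrm (br x y) <= mu * nrm x * nrm y) ->
  (0 < n)%N -> (0 < r)%N ->
  lie_function br nrm f A c ->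
  class_A nrm mu c ->
  (forall X, (forall W, f X W = X) <-> X = 0) ->
  lie_ideal br h ->
  nilpotent_lie br h ->
  (lie_prod br fullv fullv <= h)%VS ->
  (forall i, (0 < i)%N -> forall (X : {ffun 'I_n -> g}) (W : {ffun 'I_r -> g}),
     (forall j, X j \in lower_central br h i) ->
     forall j, f X W j \in lower_central br h i) ->
  schur A ->
  exists2 beta : R, 0 < beta &
    forall W : nat -> {ffun 'I_r -> g},
      (fun k => dist_pow nrm h (W k)) @ \oo --> (0 : R) ->
      (limn_esup (fun k => (sum_norm nrm (W k))%:E) <= beta%:E)%E ->
      forall X : nat -> {ffun 'I_n -> g},
        (forall k, X k.+1 = f (X k) (W k)) ->
        (fun k => sum_norm nrm (X k)) @ \oo --> (0 : R).
Proof.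
move=> brP _ nrmP /andP[mu0 _] br_mu _ _ fA cA eqm hI [p hp] comm fI schA.
have f0 W : f 0 W = 0 by apply: (proj2 (eqm 0)).
have commh x y : br x y \in h.
  by apply: subvP comm _ (mem_lie_prod brP (memvf x) (memvf y)).
have snP m := sum_norm_is_norm nrmP m.
(* If g = 0 class A provides no radius, but there is nothing to prove. *)
have [[v v0]|g0] := pselect (exists v : g, v != 0); last first.
  exists 1 => // W _ _ X _.
  have -> : (fun k => sum_norm nrm (X k)) = fun=> 0; last exact: cvg_cst.
  apply/funext => k; apply: big1 => j _.
  have [->|Xkj] := eqVneq (X k j) 0; first exact: nrm0 nrmP.
  by case: g0; exists (X k j).
have [d d0 [S S0 cS]] := class_A_majorant nrmP mu0 v0 cA.
(* Half of d, so that the limsup bound gives the bound d eventually. *)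
exists (d / 2); first exact: divr_gt0.
move=> W Wh Wsup X Xf.
have Wd : \forall k \near \oo, forall j, nrm (W k j) <= d.
  have : d / 2 < d by lra.
  move=> /(limn_esup_near_le Wsup); apply: filterS => k Wk j.
  exact: le_trans (nrm_le_sum_norm nrmP _ _) Wk.
pose H i := lower_central br h i.
have iH i : lie_ideal br (H i) by exact: lower_central_ideal.
(* A preserves the powers of H i because f does and the words in elements of
   an ideal stay in that ideal. *)
have AH i : (0 < i)%N -> forall u, vspace_pow (H i) u ->
    dist_to (sum_norm nrm (m := n)) (vspace_pow (H i)) (A u) <= 0.
  move=> i0 u Hu; apply: (dist_pow_le0 nrmP) => e e0 j.
  have subH := subspace_vspace (H i).
  have -> : A u j = f u 0 j - nonlinear_part f A u 0 j.
    by rewrite !ffunE opprB addrC subrK.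
  rewrite -[e]add0r; apply: (close_toD nrmP subH).
    by apply: (close_to_mem nrmP); exact: fI.
  apply: (close_toN nrmP subH).
  exact: (nonlinear_part_close_ideal brP nrmP fA f0 cS 0 (iH i) Hu e0 j).
have cvgH i : (fun k => dist_pow nrm (H i.+1) (X k)) @ \oo --> (0 : R).
  elim: i => [|i IH].
    apply: (schur_dist_cvg0 (snP n) schA (vspace_pow_subspace n _) (AH 1%N isT)
      (x := X) (e := fun=> 0)); first exact: cvg_cst.
    near=> k; rewrite mul0r Xf; apply: (dist_pow_le0 nrmP).
    exact: (nonlinear_part_close_commutator nrmP fA f0 cS commh).
  (* The last term makes eps k strictly larger than both distances. *)
  pose eps k := dist_pow nrm (H i.+1) (X k) + dist_pow nrm h (W k) + k.+1%:R^-1.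
  have eps_cvg : eps @ \oo --> (0 : R).
    have : eps @ \oo --> (0 + 0 + 0 : R).
      exact: cvgD (cvgD IH Wh) (@cvg_harmonic R).
    by rewrite !addr0.
  pose C := n%:R * (S * 2 / d ^+ 2 * (1 + 2 * d) + S / d + 1).
  apply: (schur_dist_cvg0 (snP n) schA (vspace_pow_subspace n _) (AH i.+2 isT)
    (x := X) (e := fun k => C * eps k)).
    by rewrite -(mulr0 C); exact: cvgMr.
  near=> k; rewrite Xf.
  have DX0 := dist_pow_ge0 nrmP (H i.+1) (X k).
  have DW0 := dist_pow_ge0 nrmP h (W k).
  have k0 : 0 < k.+1%:R^-1 :> R by rewrite invr_gt0.
  have Xeps : dist_pow nrm (H i.+1) (X k) < eps k.
    by rewrite /eps -addrA ltrDl ltr_wpDl.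
  have Weps : dist_pow nrm h (W k) < eps k.
    by rewrite /eps addrAC ltrDr ltr_wpDl.
  apply: (dist_pow_step brP nrmP mu0 br_mu fA f0 d0 S0 cS commh
    (lower_central_sub hI i.+1) (iH i.+1) (iH i.+2)).
  - by move=> x y xI yh; rewrite /H lower_centralS //; exact: mem_lie_prod.
  - apply/andP; split; first exact: le_lt_trans Xeps.
    by near: k; exact: cvg0_near_le.
  - by move=> j; exact: (close_to_dist_pow_lt nrmP j Xeps).
  - by move=> j; exact: (close_to_dist_pow_lt nrmP j Weps).
  - by near: k.
apply: (@squeeze_cvgr _ _ _ _ (fun=> 0) _ _ _ _ _ (cvgH p)).
  near=> k; rewrite (nrm_ge0 (snP n)) /= /H hp.
  exact: sum_norm_dist_pow0.
exact: cvg_cst.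
Unshelve. all: by end_near.
Qed.
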